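(* Let $(R,f,g)$ be a commutative Krasner $(m,n)$-hyperring with nonzero scalar identity $1$, and let $S$ be an $n$-ary multiplicative subset of $R$ with $1\in S$. If $P$ is an $n$-ary $wsq$-primary hyperideal of $R$ such that $P\cap S=\varnothing$, then $S^{-1}P$ is an $n$-ary $wsq$-primary hyperideal of $S^{-1}R$.
   Context: Notation: $m,n\ge 2$; $a_i^j$ denotes the sequence $a_i,a_{i+1},\dots,a_j$ (empty if $j<i$), and $a^{(k)}$ denotes $a$ repeated $k$ times. An $m$-ary hyperoperation $f$ on $R$ assigns to every $m$-tuple a nonempty subset of $R$ (a singleton is identified with its element). For nonempty subsets, $f(A_1^m)=\bigcup\{f(a_1^m): a_i\in A_i\}$ and $g(A_1^n)=\{g(a_1^n): a_i\in A_i\}$; an element $x$ in an argument stands for $\{x\}$. A canonical $m$-ary hypergroup $(R,f)$: $f$ is associative and commutative; there is a unique $0\in R$ with $f(x,0^{(m-1)})=\{x\}$ for all $x$; each $x$ has a unique $-x$ with $0\in f(x,-x,0^{(m-2)})$; and $x\in f(x_1^m)$ implies $x_i\in f(x,-x_1,\dots,-x_{i-1},-x_{i+1},\dots,-x_m)$ for each $i$. A Krasner $(m,n)$-hyperring $(R,f,g)$: $(R,f)$ is a canonical $m$-ary hypergroup, $g:R^n\to R$ is associative ($n$-ary semigroup), $g$ is distributive over $f$ in each argument, i.e. $g(a_1^{i-1},f(x_1^m),a_{i+1}^n)=f(g(a_1^{i-1},x_1,a_{i+1}^n),\dots,g(a_1^{i-1},x_m,a_{i+1}^n))$, and $0$ is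 absorbing for $g$. Commutative means $g$ is symmetric in its arguments; a scalar identity $1$ satisfies $g(x,1^{(n-1)})=x$ for all $x$. A hyperideal of $R$ is a nonempty $I\subseteq R$ that is an $m$-ary subhypergroup of $(R,f)$ (closed under $f$ and under $x\mapsto -x$) with $g(a_1^{i-1},I,a_{i+1}^n)\subseteq I$ for all $a_1^n\in R$ and all $i$. A proper hyperideal $Q$ is ($n$-ary) prime if $g(a_1^n)\in Q$ with $a_1^n\in R$ implies $a_i\in Q$ for some $i$. The radical $\mathbf{r}^{(m,n)}(I)$ of a hyperideal $I$ is the intersection of all prime hyperideals containing $I$ (equal to $R$ if there are none). A nonempty $S\subseteq R$ is an $n$-ary multiplicative subset if $g(s_1^n)\in S$ for all $s_1,\dots,s_n\in S$. Write $ab=g(a,b,1^{(n-2)})$, an associative commutative product with identity $1$ for which $g(a_1^n)=a_1a_2\cdots a_n$. The Krasner $(m,n)$-hyperring of fractions $S^{-1}R$ is the set of classes $\frac{r}{s}$ of pairs $(r,s)\in R\times S$ under the relation: $(r,s)\sim(r',s')$ iff there is $u\in S$ with $0\in g(u,f(rs',-r's,0^{(m-2)}),1^{(n-2)})$. Its operations are $F\left(\frac{r_1}{s_1},\dots,\frac{r_m}{s_m}\right)=\left\{\frac{t}{s_1\cdots s_m}: t\in f\left(r_1\prod_{j\ne1}s_j,\dots,r_m\prod_{j\ne m}s_j\right)\right\}$ and $G\left(\frac{r_1}{s_1},\dots,\frac{r_n}{s_n}\right)=\frac{g(r_1^n)}{g(s_1^n)}$; its zero is $\frac01$ and its scalar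 identity is $\frac11$. For a hyperideal $P$, $S^{-1}P=\{\frac{p}{s}: p\in P, s\in S\}$. A proper hyperideal $P$ of a commutative Krasner $(m,n)$-hyperring $R$ with scalar identity $1$ is $n$-ary $wsq$-primary (weakly strongly quasi-primary) if for all $r_1^n\in R$, $0\ne g(r_1^n)\in P$ implies $g(r_i^{(2)},1^{(n-2)})\in P$ or $g(r_1^{i-1},1,r_{i+1}^n)\in \mathbf{r}^{(m,n)}(P)$ for some $1\le i\le n$. *)

(* Defs.v *)
From HB Require Import structures.
From mathcomp Require Import all_boot all_fingroup.
From mathcomp Require Import boolp classical_sets.
From mathcomp Require Import zify.

Set Implicit Arguments.
Unset Strict Implicit.
Unset Printing Implicit Defensive.

Local Open Scope classical_set_scope.

(* Argument lists of length k are functions on 'I_k, indexed from 0. *)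

(* pad c [:: a; b] is the list (a, b, c, ..., c) of length k. *)
Definition pad k T (c : T) (s : seq T) : 'I_k -> T := fun i => nth c s i.

(* upd a i y is a_1^{i-1}, y, a_{i+1}^k. *)
Definition upd k T (a : 'I_k -> T) (i : 'I_k) (y : T) : 'I_k -> T :=
  fun l => if l == i then y else a l.

(* splice x i y is x_1^{i-1}, y, x_{k+i}^{2k-1}: the block of length k of x that
   starts at i is replaced by y.  Only the first 2k-1 terms of x are used. *)
Definition splice k T (x : nat -> T) (i : 'I_k) (y : T) : 'I_k -> T :=
  fun l => if l < i then x l else if l == i then y else x (l + k.-1).

Arguments pad k {T} c s _ /.
Arguments upd {k T} a i y _ /.
Arguments splice {k T} x i y _ /.

(* The operations alone.  Hyperideals, primes, radicals and wsq-primary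
   hyperideals depend on nothing else, and are defined at this level so that
   they make sense in a structure of fractions: there the uniqueness of the
   element z such that f(x, z^(m-1)) = {x} for all x, required below of a
   Krasner hyperring, can fail when m > 2. *)
Record hyperstructure (m n : nat) := Hyperstructure {
  carrier :> Type;
  hadd : ('I_m -> carrier) -> set carrier;
  nmul : ('I_n -> carrier) -> carrier;
  hzero : carrier;
  hopp : carrier -> carrier;
  hone : carrier
}.

Arguments hadd {m n h} _ _.
Arguments nmul {m n h} _.
Arguments hzero {m n} h.
Arguments hopp {m n h} _.
Arguments hone {m n} h.

Section Hyperrings.
Variables (m n : nat) (R : hyperstructure m n).

Definition hadd_ext (A : 'I_m -> set R) : set R :=
  [set y | exists2 a : 'I_m -> R, (forall i, A i (a i)) & hadd a y].

Definition canonical_hypergroup : Prop :=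
  [/\ forall x : 'I_m -> R, hadd x !=set0,
      forall (x : nat -> R) (i j : 'I_m),
        hadd_ext (splice (fun l => [set x l]) i (hadd (fun l => x (i + l)))) =
        hadd_ext (splice (fun l => [set x l]) j (hadd (fun l => x (j + l)))),
      forall (s : 'S_m) (x : 'I_m -> R), hadd (x \o s) = hadd x,
      forall z : R,
        (forall x : R, hadd (pad m z [:: x]) = [set x]) <-> z = hzero R &
      (forall x y : R, hadd (pad m (hzero R) [:: x; y]) (hzero R) <-> y = hopp x)
      /\
      (* the list x, -x_1, ..., -x_{i-1}, -x_{i+1}, ..., -x_m *)
      (forall (xs : nat -> R) (x : R) (i : 'I_m),
        hadd (fun l : 'I_m => xs l) x ->
        hadd (fun l : 'I_m => if l == 0 :> nat then x
                              else if l <= i then hopp (xs l.-1)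
                              else hopp (xs l)) (xs i))].

Definition krasner_hyperring : Prop :=
  [/\ canonical_hypergroup,
      forall (x : nat -> R) (i j : 'I_n),
        nmul (splice x i (nmul (fun l => x (i + l)))) =
        nmul (splice x j (nmul (fun l => x (j + l)))),
      forall (a : 'I_n -> R) (i : 'I_n) (x : 'I_m -> R),
        [set nmul (upd a i y) | y in hadd x] =
        hadd (fun k => nmul (upd a i (x k))) &
      forall (a : 'I_n -> R) (i : 'I_n), nmul (upd a i (hzero R)) = hzero R].

Definition nmul_commutative : Prop :=
  forall (s : 'S_n) (a : 'I_n -> R), nmul (a \o s) = nmul a.

Definition scalar_identity : Prop :=
  forall x : R, nmul (pad n (hone R) [:: x]) = x.

Definition hyperideal (I : set R) : Prop :=
  [/\ I !=set0,
      forall x : 'I_m -> R, (forall i, I (x i)) -> hadd x `<=` I,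
      forall x, I x -> I (hopp x) &
      forall (a : 'I_n -> R) (i : 'I_n) x, I x -> I (nmul (upd a i x))].

Definition prime_hyperideal (Q : set R) : Prop :=
  [/\ hyperideal Q, Q <> setT &
      forall a : 'I_n -> R, Q (nmul a) -> exists i, Q (a i)].

Definition hradical (I : set R) : set R :=
  \bigcap_(Q in [set Q | prime_hyperideal Q /\ I `<=` Q]) Q.

Definition wsq_primary (P : set R) : Prop :=
  [/\ hyperideal P, P <> setT &
      forall r : 'I_n -> R, nmul r <> hzero R -> P (nmul r) ->
        exists i : 'I_n, P (nmul (pad n (hone R) [:: r i; r i])) \/
                         hradical P (nmul (upd r i (hone R)))].

Definition mult_subset (S : set R) : Prop :=
  S !=set0 /\ forall s : 'I_n -> R, (forall i, S (s i)) -> S (nmul s).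

Definition bmul (a b : R) : R := nmul (pad n (hone R) [:: a; b]).

End Hyperrings.

Section Fractions.
Variables (m n : nat) (R : hyperstructure m n) (S : set R).
Hypotheses (hS : mult_subset S) (hS1 : S (hone R)).

Local Notation denom := {s : R | S s}.
Local Notation "a *b b" := (bmul a b) (at level 40, left associativity).
Local Notation "\bprod_ ( i < k | P ) F" :=
  (\big[@bmul m n R/hone R]_(i < k | P) F)
  (at level 36, F at level 36, i, k at level 50).
Local Notation "\bprod_ ( i < k ) F" := (\big[@bmul m n R/hone R]_(i < k) F)
  (at level 36, F at level 36, i, k at level 50).

Definition frac_rel (p q : R * denom) : Prop :=
  exists2 u, S u &
    [set nmul (pad n (hone R) [:: u; y]) | y in
       hadd (pad m (hzero R) [:: p.1 *b sval q.2; hopp (q.1 *b sval p.2)])]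
    (hzero R).

Definition fraction : Type :=
  {A : set (R * denom) | range (fun p => [set q | frac_rel p q]) A}.

Definition frac (r : R) (s : denom) : fraction :=
  exist _ [set q | frac_rel (r, s) q] (imageT _ (r, s)).

Definition frac_repr (x : fraction) : R * denom := sval (cid2 (svalP x)).

Lemma bmul_denom a b : S a -> S b -> S (a *b b).
Proof.
by move=> Sa Sb; apply: hS.2 => -[[|[|i]] lt_i] //=; rewrite nth_nil.
Qed.

Lemma bprod_denom k (s : 'I_k -> denom) : S (\bprod_(i < k) sval (s i)).
Proof.
by elim/big_ind: _ => // [|i _]; [exact: bmul_denom|exact: svalP].
Qed.

Definition denom_one : denom := exist _ _ hS1.
Definition denom_bprod k (s : 'I_k -> denom) : denom :=
  exist _ _ (bprod_denom s).
Definition denom_nmul (s : 'I_n -> denom) : denom :=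
  exist _ _ (hS.2 _ (fun i => svalP (s i))).

(* The operations are computed on chosen representatives; that the choice is
   irrelevant is frac_addE, frac_mulE and frac_oppE below, and frac_oppP shows
   that frac_opp is the opposite. *)
Definition frac_add (x : 'I_m -> fraction) : set fraction :=
  let r i := (frac_repr (x i)).1 in
  let s i := (frac_repr (x i)).2 in
  [set frac t (denom_bprod s) | t in
     hadd (fun i => r i *b \bprod_(j < m | j != i) sval (s j))].

Definition frac_mul (x : 'I_n -> fraction) : fraction :=
  frac (nmul (fun i => (frac_repr (x i)).1))
       (denom_nmul (fun i => (frac_repr (x i)).2)).

Definition frac_opp (x : fraction) : fraction :=
  frac (hopp (frac_repr x).1) (frac_repr x).2.

Definition fractions : hyperstructure m n :=
  Hyperstructure frac_add frac_mul (frac (hzero R) denom_one) frac_opp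
                 (frac (hone R) denom_one).

Definition frac_ideal (P : set R) : set fractions :=
  [set x | exists2 p, P p & exists s : denom, x = frac p s].

End Fractions.

Arguments frac_ideal {m n R S} hS hS1 P _.

Section Theory.
Variables (m n : nat) (R : hyperstructure m n).
Hypotheses (hm : 1 < m) (hn : 1 < n).
Hypotheses (hR : krasner_hyperring R) (hC : nmul_commutative R).
Hypothesis (h1 : scalar_identity R).

Local Notation "a *b b" := (bmul a b) (at level 40, left associativity).
Local Notation e := (hone R).
Local Notation o := (hzero R).

Lemma nmul1 : nmul (pad n e [::]) = e.
Proof.
rewrite -[RHS]h1; congr nmul; apply: funext => -[[|i] ?] //=.
by rewrite nth_nil.
Qed.

Lemma nmul_cons (x : R) s :
  size s < n -> nmul (pad n e (x :: s)) = x *b nmul (pad n e s).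
Proof.
move=> hs; have [_ gA _ _] := hR.
have /= := gA (nth e (x :: s)) (Ordinal (ltnW hn)) (Ordinal hn).
rewrite [X in nmul X = _](_ : _ = pad n e [:: nmul (pad n e (x :: s))]).
  rewrite h1 => ->; congr nmul; apply: funext => -[[|[|i]] hi] //=.
  by rewrite !nth_default //=; lia.
apply: funext => -[[|i] hi] //=; rewrite nth_nil nth_default //=; lia.
Qed.

Lemma bmulC (a b : R) : a *b b = b *b a.
Proof.
rewrite /bmul -(hC (tperm (Ordinal (ltnW hn)) (Ordinal hn))).
congr nmul; apply: funext => i /=.
case: tpermP => [->|->|] //=.
case: i => -[|[|i]] hi ne0 ne1 //=.
  by case: ne0; apply: val_inj.
by case: ne1; apply: val_inj.
Qed.

Lemma bmul1 (a : R) : a *b e = a.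
Proof. by rewrite -{1}nmul1 -nmul_cons ?h1 // ltnW. Qed.

Lemma bmul1l (a : R) : e *b a = a. Proof. by rewrite bmulC bmul1. Qed.

Lemma nmul_foldr (s : seq R) :
  size s <= n -> nmul (pad n e s) = foldr (@bmul m n R) e s.
Proof.
elim: s => [|x s IH] hs; first by rewrite nmul1.
by rewrite nmul_cons //= IH // ltnW.
Qed.

Lemma bmulA : associative (@bmul m n R).
Proof.
move=> a b c; have [_ gA _ _] := hR.
pose s := b :: nseq n.-2 e ++ [:: c].
have sE : size s = n by rewrite /= size_cat size_nseq /=; lia.
have bcE : nmul (pad n e s) = b *b c.
  rewrite nmul_foldr ?sE //= foldr_cat /= bmul1; congr (_ *b _).
  by elim: n.-2 => //= k ->; rewrite bmul1l.
have catE k : nth e s k = if k == 0 then b else if k == n.-1 then c else e.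
  case: k => //= k; rewrite nth_cat size_nseq nth_nseq.
  have -> : (k.+1 == n.-1) = (k == n.-2) by lia.
  case: ltngtP => [//|lt_k|->]; last by rewrite subnn.
  by rewrite nth_default //= subn_gt0.
have /= := gA (nth e (a :: s)) (Ordinal hn) (Ordinal (ltnW hn)).
rewrite [X in nmul X = _](_ : _ = pad n e [:: a; nmul (pad n e s)]); last first.
  apply: funext => -[[|[|i]] hi] //=; rewrite nth_nil nth_default //.
  by move: sE => /=; lia.
rewrite bcE => E; apply: (etrans E); congr nmul => {E}.
apply: funext => -[[|i] hi] /=.
  congr nmul; apply: funext => -[[|l] hl] //; rewrite add0n.
  rewrite [LHS]catE [RHS]/=; case: l hl => //= l hl; rewrite nth_nil ifN //; lia.
rewrite [LHS]catE.
case: i hi => [|i] hi; first by rewrite ifN ?ifT //; lia.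
by rewrite !ifN //= ?nth_nil //; lia.
Qed.

Definition bmul_law : Monoid.com_law e :=
  HB.pack (@bmul m n R) (Monoid.isComLaw.Build R e (@bmul m n R)
    bmulA bmulC bmul1l).


Lemma bmul_hadd (a : R) (x : 'I_m -> R) :
  [set a *b y | y in hadd x] = hadd (fun k => a *b x k).
Proof.
have [_ _ dist _] := hR.
have E (y : R) : upd (pad n e [:: a]) (Ordinal hn) y = pad n e [:: a; y].
  by apply: funext => -[[|[|l]] hl] //=; rewrite !nth_nil.
have := dist (pad n e [:: a]) (Ordinal hn) x.
rewrite (_ : (fun k => _) = (fun k => a *b x k)).
  by move=> <-; apply: eq_imagel => y _; rewrite E.
by apply: funext => k; rewrite E.
Qed.

Lemma bmul0 (a : R) : a *b o = o.
Proof.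
have [_ _ _ abs] := hR.
rewrite -[RHS](abs (pad n e [:: a]) (Ordinal hn)).
by congr nmul; apply: funext => -[[|[|l]] hl] //=; rewrite !nth_nil.
Qed.

Lemma hadd2C (x y : R) : hadd (pad m o [:: x; y]) = hadd (pad m o [:: y; x]).
Proof.
have [[_ _ fC _ _] _ _ _] := hR.
rewrite -(fC (tperm (Ordinal (ltnW hm)) (Ordinal hm))).
congr hadd; apply: funext => i /=.
case: tpermP => [->|->|] //=.
case: i => -[|[|i]] hi ne0 ne1 //=.
  by case: ne0; apply: val_inj.
by case: ne1; apply: val_inj.
Qed.

Lemma hadd2_eq0 (x y : R) : hadd (pad m o [:: x; y]) o <-> y = hopp x.
Proof. by have [[_ _ _ _ []]] := hR. Qed.

Lemma hoppK : involutive (@hopp m n R).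
Proof.
by move=> x; symmetry; apply/hadd2_eq0; rewrite hadd2C; apply/hadd2_eq0.
Qed.

Lemma bmul_hadd2 (a x y : R) : [set a *b z | z in hadd (pad m o [:: x; y])] =
  hadd (pad m o [:: a *b x; a *b y]).
Proof.
rewrite bmul_hadd; congr hadd; apply: funext => -[[|[|l]] hl] //=.
by rewrite !nth_nil bmul0.
Qed.

Lemma bmulN (a x : R) : a *b hopp x = hopp (a *b x).
Proof.
apply/hadd2_eq0; rewrite -bmul_hadd2; exists o; last exact: bmul0.
exact/hadd2_eq0.
Qed.

Lemma nmul_bprod (a : 'I_n -> R) : nmul a = \big[@bmul m n R/e]_(i < n) a i.
Proof.
have -> : \big[@bmul m n R/e]_(i < n) a i = \big[bmul_law/e]_(i <- enum 'I_n) a i.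
  by rewrite big_enum.
rewrite unlock.
have := @nmul_foldr (map a (enum 'I_n)); rewrite size_map size_enum_ord.
move=> /(_ (leqnn _)) E; apply: etrans (etrans E _).
  congr nmul; apply: funext => i /=.
  by rewrite (nth_map i) ?size_enum_ord // nth_ord_enum.
by elim: (enum 'I_n) => //= i s ->.
Qed.

Variable S : set R.
Hypotheses (hS : mult_subset S) (hS1 : S e).
Local Notation denom := {s : R | S s}.
Local Notation "x //b s" := (@frac m n R S x s) (at level 40).

Lemma frac_relP (p q : R * denom) : frac_rel p q <->
  exists2 u, S u & u *b (p.1 *b sval q.2) = u *b (q.1 *b sval p.2).
Proof.
have E (u : R) : [set nmul (pad n e [:: u; y]) | y in
       hadd (pad m o [:: p.1 *b sval q.2; hopp (q.1 *b sval p.2)])] o <->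
    u *b (p.1 *b sval q.2) = u *b (q.1 *b sval p.2).
  have := bmul_hadd2 u (p.1 *b sval q.2) (hopp (q.1 *b sval p.2)).
  rewrite /bmul => ->; rewrite hadd2_eq0 -![nmul _]/(_ *b _) bmulN.
  by split=> [/(can_inj hoppK) ->|->].
by split=> -[u Su] /E; exists u.
Qed.

Lemma frac_eqP (r r' : R) (s s' : denom) : r //b s = r' //b s' <->
  exists2 u, S u & u *b (r *b sval s') = u *b (r' *b sval s).
Proof.
split=> [/(congr1 sval) /= /seteqP [_ sub]|[u Su uE]].
  apply/(frac_relP (r, s) (r', s')); apply: sub => /=.
  by apply/frac_relP; exists e.
apply: eq_exist; apply/seteqP; split=> -[t w] /= /frac_relP [v Sv /= vE];
  apply/frac_relP.
  exists (u *b v *b sval s).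
    by apply: (bmul_denom hS hS1 (bmul_denom hS hS1 Su Sv)); exact: svalP.
  transitivity (u *b (r' *b sval s) *b v *b sval w).
    by apply: bmul_law.[AC (3*2) (1*(4*3)*2*5)].
  rewrite -uE; transitivity (v *b (r *b sval w) *b u *b sval s').
    by apply: bmul_law.[AC (1*2*1*1) (4*(2*5)*1*3)].
  by rewrite vE; apply: bmul_law.[AC (1*2*1*1) (4*1*3*(2*5))].
exists (u *b v *b sval s').
  by apply: (bmul_denom hS hS1 (bmul_denom hS hS1 Su Sv)); exact: svalP.
transitivity (u *b (r *b sval s') *b v *b sval w).
  by apply: bmul_law.[AC (3*2) (1*(4*3)*2*5)].
rewrite uE; transitivity (v *b (r' *b sval w) *b u *b sval s).
  by apply: bmul_law.[AC (1*2*1*1) (4*(2*5)*1*3)].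
by rewrite vE; apply: bmul_law.[AC (1*2*1*1) (4*1*3*(2*5))].
Qed.

Lemma frac_reprK (x : fraction S) : (frac_repr x).1 //b (frac_repr x).2 = x.
Proof.
rewrite /frac_repr; case: cid2 => -[r s] _ /= E.
by case: x E => A hA /= E; exact: eq_exist.
Qed.

Lemma fracW (x : fraction S) : exists r s, x = r //b s.
Proof. by exists (frac_repr x).1, (frac_repr x).2; rewrite frac_reprK. Qed.

Lemma frac_addE (r : 'I_m -> R) (s : 'I_m -> denom) :
  frac_add hS hS1 (fun i => r i //b s i) =
  [set t //b denom_bprod hS hS1 s | t in
     hadd (fun i => r i *b \big[@bmul m n R/e]_(j < m | j != i) sval (s j))].
Proof.
have wd (a b : 'I_m -> R) (c d : 'I_m -> denom) :
    (forall i, a i //b c i = b i //b d i) ->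
  [set t //b denom_bprod hS hS1 c | t in
     hadd (fun i => a i *b \big[@bmul m n R/e]_(j < m | j != i) sval (c j))] `<=`
  [set t //b denom_bprod hS hS1 d | t in
     hadd (fun i => b i *b \big[@bmul m n R/e]_(j < m | j != i) sval (d j))].
  move=> ab.
  have /choice [u uE] : forall i, exists u : denom,
      sval u *b (a i *b sval (d i)) = sval u *b (b i *b sval (c i)).
    by move=> i; have /frac_eqP [u Su uE] := ab i; exists (exist _ u Su).
  set U := denom_bprod hS hS1 u.
  set C := denom_bprod hS hS1 c; set D := denom_bprod hS hS1 d.
  have key i : sval U *b sval D *b
        (a i *b \big[@bmul m n R/e]_(j < m | j != i) sval (c j)) =
      sval U *b sval C *b
        (b i *b \big[@bmul m n R/e]_(j < m | j != i) sval (d j)).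
    have bigE (v : 'I_m -> denom) : sval (denom_bprod hS hS1 v) =
        sval (v i) *b \big[@bmul m n R/e]_(j < m | j != i) sval (v j).
      rewrite -[LHS]/(\big[bmul_law/e]_(j < m) sval (v j)) (bigD1 i) //=.
    rewrite !bigE.
    move: (\big[_/_]_(_ < m | _) sval (u _)) => pu.
    move: (\big[_/_]_(_ < m | _) sval (c _)) => pc.
    move: (\big[_/_]_(_ < m | _) sval (d _)) => pd.
    transitivity (sval (u i) *b (a i *b sval (d i)) *b pu *b pc *b pd).
      by apply: bmul_law.[AC (2*2*2) ((1*(5*3)*2*6*4))].
    by rewrite uE; apply: bmul_law.[AC (1*2*1*1*1) (1*4*(3*5)*(2*6))].
  move=> _ [t ft <-].
  have : [set sval U *b sval D *b y | y in
      hadd (fun i => a i *b \big[@bmul m n R/e]_(j < m | j != i) sval (c j))]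
    (sval U *b sval D *b t) by exists t.
  rewrite bmul_hadd (funext key) -bmul_hadd => -[t' ft' tE].
  exists t' => //; apply/frac_eqP; exists (sval U); first exact: svalP.
  transitivity (sval U *b sval C *b t').
    by apply: bmul_law.[AC (1*2) (1*3*2)].
  by rewrite tE; apply: bmul_law.[AC 3 (1*(3*2))].
by apply/seteqP; split; apply: wd => i; rewrite frac_reprK.
Qed.

Lemma frac_mulE (r : 'I_n -> R) (s : 'I_n -> denom) :
  frac_mul hS (fun i => r i //b s i) = nmul r //b denom_nmul hS s.
Proof.
have /choice [u uE] : forall i, exists u : denom,
    sval u *b ((frac_repr (r i //b s i)).1 *b sval (s i)) =
    sval u *b (r i *b sval (frac_repr (r i //b s i)).2).
  move=> i; have /frac_eqP [u Su uE] := frac_reprK (r i //b s i).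
  by exists (exist _ u Su).
apply/frac_eqP; exists (sval (denom_nmul hS u)); first exact: svalP.
have bprodM (a b : 'I_n -> R) :
    nmul a *b nmul b = nmul (fun i => a i *b b i).
  rewrite !nmul_bprod -[RHS]/(\big[bmul_law/e]_(i < n) (bmul_law (a i) (b i))).
  by rewrite big_split.
rewrite /= !bprodM; congr nmul; apply: funext => i.
exact: uE.
Qed.

Lemma frac_oppE (r : R) (s : denom) : frac_opp (r //b s) = hopp r //b s.
Proof.
have /frac_eqP [u Su uE] := frac_reprK (r //b s).
apply/frac_eqP; exists u => //.
by rewrite ![hopp _ *b _]bmulC !bmulN ![sval _ *b _]bmulC uE.
Qed.

Lemma frac_eqdenom (r r' : R) (s : denom) :
  r //b s = r' //b s <-> exists2 u, S u & u *b r = u *b r'.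
Proof.
rewrite frac_eqP; split=> -[u Su uE].
  exists (u *b sval s); first by apply: (bmul_denom hS hS1 Su); exact: svalP.
  by rewrite ![u *b _ *b _]bmul_law.[AC 3 (1*(3*2))].
by exists u => //; rewrite !bmulA uE.
Qed.


Lemma frac_add_common (a : 'I_m -> R) (d : denom) :
  frac_add hS hS1 (fun i => a i //b d) = [set t //b d | t in hadd a].
Proof.
pose q := iter m.-1 (@bmul m n R (sval d)) e.
have qE i : \big[@bmul m n R/e]_(j < m | j != i) sval d = q.
  by rewrite big_const (cardC1 i) card_ord.
have dE : sval (denom_bprod hS hS1 (fun _ : 'I_m => d)) = sval d *b q.
  rewrite /= big_const_ord -iterS; congr (iter _ _ _); lia.
have fracq t : (q *b t) //b denom_bprod hS hS1 (fun _ : 'I_m => d) = t //b d.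
  apply/frac_eqP; exists e => //; rewrite !bmul1l.
    apply: etrans (congr1 (bmul t) (esym dE)).
  by apply: bmul_law.[AC 3 (2*(3*1))].
rewrite frac_addE.
rewrite [X in hadd X](_ : _ = fun i => q *b a i); last first.
  by apply: funext => i; rewrite qE bmulC.
rewrite -bmul_hadd; apply/seteqP; split=> [_ [_ [t ft <-] <-]|_ [t ft <-]].
  by exists t.
by exists (q *b t) => //; exists t.
Qed.

Lemma frac0 (d : denom) : o //b d = hzero (fractions hS hS1).
Proof.
by apply/frac_eqP; exists e => //; rewrite ![o *b _]bmulC !bmul0.
Qed.

Lemma frac_oppP (x y : fractions hS hS1) :
  hadd (pad m (hzero (fractions hS hS1)) [:: x; y]) (hzero (fractions hS hS1))
  <-> y = hopp x.
Proof.
have [r [s ->]] := fracW x; have [r' [s' ->]] := fracW y.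
pose w : denom := exist _ _ (bmul_denom hS hS1 (svalP s) (svalP s')).
set a := r *b sval s'; set b := r' *b sval s.
have -> : r //b s = a //b w.
  apply/frac_eqP; exists e => //; rewrite !bmul1l.
  by apply: bmul_law.[AC (1*2) ((1*3)*2)].
have -> : r' //b s' = b //b w.
  apply/frac_eqP; exists e => //; rewrite !bmul1l.
  by apply: bmul_law.[AC (1*2) ((1*2)*3)].
rewrite [hopp _]frac_oppE -[in X in X <-> _](frac0 w).
rewrite [pad m _ _](_ : _ = fun i => pad m o [:: a; b] i //b w); last first.
  by apply: funext => -[[|[|i]] hi] //=; rewrite !nth_nil.
rewrite [hadd _]frac_add_common frac_eqdenom; split.
  case=> t ft /frac_eqdenom [u Su]; rewrite bmul0 => ut0.
  exists u => //; rewrite bmulN; apply/hadd2_eq0; rewrite -bmul_hadd2.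
  by exists t.
case=> u Su; rewrite bmulN => /hadd2_eq0; rewrite -bmul_hadd2 => -[t ft ut0].
by exists t => //; apply/frac_eqdenom; exists u => //; rewrite bmul0.
Qed.

End Theory.

(* Main.v *)
Require Import Defs.
From mathcomp Require Import all_boot.
From mathcomp Require Import boolp classical_sets.
Local Open Scope classical_set_scope.

(** Both the property to be proved and the radical occurring in it can be read
    off from numerators.  On the one hand, [r/s] lies in [S^-1 P] exactly when
    [v r] lies in [P] for some [v] in [S] (frac_ideal_fracP).  On the other
    hand, a hyperideal [Q] of [S^-1 R] contains [r/s] exactly when it contains
    [r/1], because [s/1] is invertible; so [Q] is determined by its contraction
    [{r | r/1 in Q}] (hyperideal_fracE), from which factors in [S] can be
    cancelled (contraction_cancel).

    Let [0 <> G(r_1/s_1, ..., r_n/s_n)] be in [S^-1 P].  Then some [v] in [S]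
    has [v g(r_1, ..., r_n)] in [P], and this element is not [0] since the
    fraction is not.  Absorb [v] into the first argument and apply the
    hypothesis on [P] to [v r_1, r_2, ..., r_n].  Either the square of one of
    these arguments is in [P], and then the square of the corresponding fraction
    is in [S^-1 P]; or the product of all but one of them is in the radical of
    [P].  In that case let [Q] be a prime of [S^-1 R] containing [S^-1 P].  Its
    contraction is a prime of [R] containing [P] (prime_contraction), hence
    contains that product, and cancelling the possible factor [v] shows that the
    product of the corresponding fractions is in [Q]. *)

Set Implicit Arguments.
Unset Strict Implicit.
Unset Printing Implicit Defensive.

Section FractionsOfHyperideals.
Variables (m n : nat) (R : hyperstructure m n).
Hypotheses (hm : 1 < m) (hn : 1 < n).
Hypotheses (hR : krasner_hyperring R) (hC : nmul_commutative R).
Hypothesis (h1 : scalar_identity R).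

Local Notation "a *b b" := (bmul a b) (at level 40, left associativity).
Local Notation e := (hone R).
Local Notation o := (hzero R).
Local Notation law := (bmul_law hm hn hR hC h1).

Lemma nmulM (a b : 'I_n -> R) : nmul (fun i => a i *b b i) = nmul a *b nmul b.
Proof.
rewrite !(nmul_bprod hm hn hR hC h1).
rewrite -[LHS]/(\big[law/e]_(i < n) (law (a i) (b i))).
by rewrite big_split.
Qed.

Lemma nmul_upd1 (i : 'I_n) (y : R) : nmul (upd (fun=> e) i y) = y.
Proof.
rewrite (nmul_bprod hm hn hR hC h1) -[LHS]/(\big[law/e]_(l < n) _).
rewrite (bigD1 i) // big1 => [|l /negPf /= ->] //=; rewrite eqxx.
exact: (bmul1 hm hn hR h1).
Qed.

Lemma hyperideal_bmul (I : set R) (a x : R) :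
  hyperideal I -> I x -> I (a *b x).
Proof.
move=> [_ _ _ Imul] Ix; have := Imul (pad n e [:: a]) (Ordinal hn) x Ix.
congr I; congr nmul; apply: funext => -[[|[|l]] hl] //=.
by rewrite !nth_nil.
Qed.

Variable S : set R.
Hypotheses (hS : mult_subset S) (hS1 : S e).
Local Notation denom := {s : R | S s}.
Local Notation "x //b s" := (@frac m n R S x s) (at level 40).
Local Notation SR := (fractions hS hS1).
Local Notation one := (denom_one hS1).

Let feq := frac_eqP hm hn hR hC h1 hS hS1.

Definition denom_bmul (s t : denom) : denom :=
  exist _ _ (bmul_denom hS hS1 (svalP s) (svalP t)).

Lemma frac_bmulE (r r' : R) (s s' : denom) :
  @bmul m n SR (r //b s) (r' //b s') = (r *b r') //b denom_bmul s s'.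
Proof.
rewrite /bmul (_ : pad n _ _ = fun i =>
  pad n e [:: r; r'] i //b pad n one [:: s; s'] i); last first.
  by apply: funext => -[[|[|l]] hl] //=; rewrite !nth_nil.
rewrite [LHS](frac_mulE hm hn hR hC h1 hS hS1); congr frac.
apply: eq_exist; congr nmul; apply: funext => -[[|[|l]] hl] //=.
by rewrite !nth_nil.
Qed.

Lemma frac_cancel (v : denom) (r : R) (s : denom) :
  (sval v *b r) //b denom_bmul v s = r //b s.
Proof.
apply/feq; exists e => //; congr bmul.
by apply: law.[AC (2*1) (2*(1*3))].
Qed.

Lemma fracsW k (x : 'I_k -> SR) :
  exists r s, x = fun i => r i //b s i.
Proof.
exists (fun i => (frac_repr (x i)).1), (fun i => (frac_repr (x i)).2).
by apply: funext => i; rewrite frac_reprK.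
Qed.

(** The existential quantifier is unavoidable: [r/s] may have a numerator in [P]
    without [r] itself being in [P], as nothing makes [P] prime. *)
Lemma frac_ideal_fracP (P : set R) (r : R) (s : denom) : hyperideal P ->
  frac_ideal hS hS1 P (r //b s) <-> exists v : denom, P (sval v *b r).
Proof.
move=> Pid; split=> [[p Pp [t /feq [u Su uE]]]|[v Pvr]].
  exists (denom_bmul (exist _ u Su) t).
  have -> : sval (denom_bmul (exist _ u Su) t) *b r = u *b (r *b sval t).
    by apply: law.[AC (2*1) (1*(3*2))].
  rewrite uE; apply: hyperideal_bmul => //.
  by rewrite (bmulC hn hC); exact: hyperideal_bmul.
by exists (sval v *b r) => //; exists (denom_bmul v s); rewrite frac_cancel.
Qed.

Lemma hyperideal_frac_ideal (P : set R) :
  hyperideal P -> hyperideal (frac_ideal hS hS1 P).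
Proof.
move=> Pid; have [[p Pp] Padd Popp Pmul] := Pid; split.
- by exists (p //b one); exists p => //; exists one.
- move=> x Px.
  have /choice [q qP] : forall i, exists q : R * denom,
      P q.1 /\ x i = q.1 //b q.2.
    by move=> i; have [q Pq [s ->]] := Px i; exists (q, s).
  have -> : x = fun i => (q i).1 //b (q i).2.
    by apply: funext => i; have [] := qP i.
  rewrite [hadd _](frac_addE hm hn hR hC h1 hS hS1) => _ [t qt <-].
  exists t; last by eexists.
  apply: Padd qt => i; rewrite (bmulC hn hC); apply: hyperideal_bmul => //.
  by have [] := qP i.
- move=> _ [q Pq [s ->]]; rewrite [hopp _](frac_oppE hm hn hR hC h1 hS hS1).
  by exists (hopp q); [exact: Popp|exists s].
- move=> a i _ [q Pq [t ->]]; have [r [s ->]] := fracsW a.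
  rewrite (_ : upd _ _ _ = fun l => upd r i q l //b upd s i t l); last first.
    by apply: funext => l /=; case: eqP.
  rewrite [nmul _](frac_mulE hm hn hR hC h1 hS hS1).
  by exists (nmul (upd r i q)); [exact: Pmul|eexists].
Qed.

Lemma frac_ideal_proper (P : set R) :
  hyperideal P -> P `&` S = set0 -> frac_ideal hS hS1 P <> setT.
Proof.
move=> Pid PS0 PT.
have : frac_ideal hS hS1 P (e //b one) by rewrite PT.
move=> /(frac_ideal_fracP _ _ Pid) [[v Sv]] /=.
rewrite (bmul1 hm hn hR h1) => Pv.
by have : (P `&` S) v by []; rewrite PS0.
Qed.

Definition contraction (Q : set SR) : set R := [set r | Q (r //b one)].

Lemma hyperideal_bmul_frac (Q : set SR) (x y : SR) :
  hyperideal Q -> Q x -> Q (@bmul m n SR y x).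
Proof.
move=> [_ _ _ Qmul] Qx.
have := Qmul (pad n (hone SR) [:: y]) (Ordinal hn) x Qx.
congr Q; congr nmul; apply: funext => -[[|[|l]] hl] //=.
by rewrite !nth_nil.
Qed.

(** Multiplying [r/s] by [s/1], or [r/1] by [1/s], stays in [Q]. *)
Lemma hyperideal_fracE (Q : set SR) (r : R) (s : denom) :
  hyperideal Q -> Q (r //b s) <-> contraction Q r.
Proof.
move=> Qid; split=> [Qrs|Qr].
  have := hyperideal_bmul_frac (sval s //b one) Qid Qrs.
  rewrite frac_bmulE; congr Q; apply/feq; exists e => //; congr bmul => /=.
  by apply: law.[AC (2*1) (2*(3*1))].
have := hyperideal_bmul_frac (e //b s) Qid Qr.
rewrite frac_bmulE; congr Q; apply/feq; exists e => //; congr bmul => /=.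
by rewrite (bmul1l hm hn hR hC h1) (bmul1 hm hn hR h1).
Qed.

(** The fractions [(v r)/v] and [r/1] are equal, and denominators do not affect
    membership in [Q]. *)
Lemma contraction_cancel (Q : set SR) (v : denom) (r : R) :
  hyperideal Q -> contraction Q (sval v *b r) -> contraction Q r.
Proof.
move=> Qid /(hyperideal_fracE _ (denom_bmul v one) Qid).
by rewrite frac_cancel.
Qed.

Lemma contraction_nmul (Q : set SR) (r : 'I_n -> R) (s : 'I_n -> denom) :
  hyperideal Q ->
  Q (nmul (fun i => r i //b s i : SR)) <-> contraction Q (nmul r).
Proof.
move=> Qid; rewrite [nmul _](frac_mulE hm hn hR hC h1 hS hS1).
exact: hyperideal_fracE.
Qed.

Lemma hyperideal_contraction (Q : set SR) :
  hyperideal Q -> hyperideal (contraction Q).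
Proof.
move=> Qid; have [[x Qx] Qadd Qopp Qmul] := Qid; split.
- have [r [s xE]] := fracW x.
  by exists r; apply/(hyperideal_fracE r s Qid); rewrite -xE.
- move=> y Qy t yt; apply: (Qadd (fun i => y i //b one)) => //.
  by rewrite [hadd _](frac_add_common hm hn hR hC h1 hS hS1); exists t.
- by move=> r /Qopp; rewrite [hopp _](frac_oppE hm hn hR hC h1 hS hS1).
- move=> a i r Qr; apply/(contraction_nmul _ (fun=> one) Qid).
  have := Qmul (fun l => a l //b one) i _ Qr.
  congr Q; congr nmul; apply: funext => l /=.
  by case: eqP.
Qed.

(** This bounds the radical of an extended hyperideal from below: each prime
    above [S^-1 P] contracts to one of the primes whose intersection is the
    radical of [P]. *)
Lemma prime_contraction (Q : set SR) :
  prime_hyperideal Q -> prime_hyperideal (contraction Q).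
Proof.
move=> [Qid QT Qprime]; split; first exact: hyperideal_contraction.
- move=> cT; apply: QT; apply/seteqP; split=> // x _.
  have [r [s ->]] := fracW x.
  by apply/(hyperideal_fracE r s Qid); rewrite cT.
- by move=> a /(contraction_nmul _ (fun=> one) Qid) /Qprime.
Qed.

Lemma wsq_primary_frac_ideal (P : set R) :
  wsq_primary P -> P `&` S = set0 -> wsq_primary (frac_ideal hS hS1 P).
Proof.
move=> [Pid _ Pwsq] PS0; split.
- exact: hyperideal_frac_ideal.
- exact: frac_ideal_proper.
move=> x; have [r [s ->]] := fracsW x.
rewrite [nmul _](frac_mulE hm hn hR hC h1 hS hS1) => rs0.
move=> /(frac_ideal_fracP _ _ Pid) [v Pvr].
(* Absorbing [v] into the first argument is multiplying [r l] by [w l], where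
   [w] is [v, 1, ..., 1].  Every [w l] is a denominator, so the index where [v]
   sits needs no separate treatment. *)
pose w : 'I_n -> denom := upd (fun=> one) (Ordinal (ltnW hn)) v.
have wrE : nmul (fun l => sval (w l) *b r l) = sval v *b nmul r.
  rewrite nmulM -[in RHS](nmul_upd1 (Ordinal (ltnW hn)) (sval v)).
  by congr (nmul _ *b _); apply: funext => l; rewrite /w /=; case: eqP.
have [||i iP] := Pwsq (fun l => sval (w l) *b r l).
- rewrite wrE => vr0; apply: rs0.
  rewrite -(frac0 hm hn hR hC h1 hS hS1 (denom_nmul hS s)).
  apply/(frac_eqdenom hm hn hR hC h1 hS hS1); exists (sval v); first exact: svalP.
  by rewrite (bmul0 hn hR).
- by rewrite wrE.
exists i; case: iP => [Psq|Prad]; [left|right].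
  rewrite -/(bmul _ _) frac_bmulE; apply/(frac_ideal_fracP _ _ Pid).
  exists (denom_bmul (w i) (w i)); move: Psq; rewrite -/(bmul _ _).
  by congr P; apply: law.[AC (2*2) ((1*3)*(2*4))].
move=> Q /= [Qprime PQ]; have [Qid _ _] := Qprime.
rewrite (_ : upd _ i _ = fun l => upd r i e l //b upd s i one l); last first.
  by apply: funext => l /=; case: eqP.
apply/(contraction_nmul _ _ Qid).
apply: (contraction_cancel (v := denom_nmul hS (upd w i one)) Qid).
rewrite /= -nmulM.
have := Prad (contraction Q); rewrite /= (_ : upd _ _ _ = fun l =>
    sval (upd w i one l) *b upd r i e l); last first.
  by apply: funext => l /=; case: eqP => //; rewrite (bmul1 hm hn hR h1).
apply; split; first exact: prime_contraction.
by move=> p Pp; apply: PQ; exists p => //; exists one.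
Qed.

End FractionsOfHyperideals.

Theorem theorem4p14 (m n : nat) (hm : 2 <= m) (hn : 2 <= n)
    (R : hyperstructure m n)
    (hR : krasner_hyperring R) (hcomm : nmul_commutative R)
    (hid : scalar_identity R) (hone_neq0 : hone R <> hzero R)
    (S : set R) (hS : mult_subset S) (hS1 : S (hone R))
    (P : set R) (hP : wsq_primary P) (hPS : P `&` S = set0) :
  wsq_primary (frac_ideal hS hS1 P).
Proof. exact: wsq_primary_frac_ideal. Qed.
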